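(* Let $G=(V,E)$ be an undirected graph with nonnegative node weights $w_v\ge 0$ for $v\in V$, and let $\mathcal{C}$ be the (random) set returned by \textsc{NeighborCover} on $G$. Then $\mathcal{C}$ is a vertex cover of $G$ and $$\mathbb{E}\Big[\sum_{v\in\mathcal{C}} w_v\Big]\le 2\cdot \min\Big\{\sum_{v\in S} w_v : S\subseteq V \text{ is a vertex cover of } G\Big\}.$$ That is, \textsc{NeighborCover} is a randomized 2-approximation algorithm for minimum weighted vertex cover.
   Context: A vertex cover of $G$ is a set $S\subseteq V$ such that every edge of $E$ has at least one endpoint in $S$. $N(u)$ denotes the set of neighbors of $u$. The algorithm \textsc{NeighborCover}$(G)$: initialize $\mathcal{C}\leftarrow\emptyset$, $\mathcal{I}\leftarrow\emptyset$, $\mathcal{U}\leftarrow V$ (the set of ''undecided'' nodes). While $\mathcal{U}\neq\emptyset$: select a node $u\in\mathcal{U}$ at random with probability proportional to its weight, i.e. with probability $w_u/\sum_{x\in\mathcal{U}}w_x$ (independently of previous choices); set $\mathcal{I}\leftarrow\mathcal{I}\cup\{u\}$ and remove $u$ from $\mathcal{U}$; for each $v\in N(u)\cap\mathcal{U}$, add $v$ to $\mathcal{C}$ and remove $v$ from $\mathcal{U}$. When $\mathcal{U}=\emptyset$, return $\mathcal{C}$. *)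

(* Defs.v *)
From mathcomp Require Import all_boot all_order all_algebra.

Set Implicit Arguments.
Unset Strict Implicit.
Unset Printing Implicit Defensive.

Import Order.TTheory GRing.Theory Num.Theory.
Local Open Scope ring_scope.

(* Probability laws on a finite type are given by their mass functions. *)
Definition is_law (R : realFieldType) (T : finType) (p : T -> R) : Prop :=
  (forall x, 0 <= p x) /\ \sum_x p x = 1.

Definition law_ret (R : realFieldType) (T : finType) (x : T) : T -> R :=
  fun y => (y == x)%:R.

Definition law_bind (R : realFieldType) (T U : finType) (p : T -> R)
    (k : T -> U -> R) : U -> R :=
  fun y => \sum_x p x * k x y.

Definition expectation (R : realFieldType) (T : finType) (p : T -> R)
    (f : T -> R) : R :=
  \sum_x p x * f x.

Definition nbhd (V : finType) (e : rel V) (u : V) : {set V} :=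
  [set v | e u v].

Definition vertex_cover (V : finType) (e : rel V) (S : {set V}) : bool :=
  [forall u, forall v, e u v ==> (u \in S) || (v \in S)].

Definition weight (R : realFieldType) (V : finType) (w : V -> R)
    (S : {set V}) : R :=
  \sum_(v in S) w v.

(* The default value of the iterated minimum is the weight of [set: V], which
   is itself a vertex cover: this is the minimum over a nonempty family. *)
Definition min_cover_weight (R : realFieldType) (V : finType) (e : rel V)
    (w : V -> R) : R :=
  \big[Num.min/weight w [set: V]]_(S : {set V} | vertex_cover e S) weight w S.

(* The quotient w u / w(U) is meaningless when all the undecided nodes have
   weight zero. In that case the node is drawn according to tie U, an arbitrary
   law on U (see tie_law). *)
Definition select (R : realFieldType) (V : finType) (w : V -> R)
    (tie : {set V} -> V -> R) (U : {set V}) : V -> R :=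
  fun u => if u \notin U then 0
           else if weight w U == 0 then tie U u
           else w u / weight w U.

Definition tie_law (R : realFieldType) (V : finType)
    (tie : {set V} -> V -> R) : Prop :=
  forall U : {set V}, U != set0 ->
    (forall u, u \in U -> 0 <= tie U u) /\ \sum_(u in U) tie U u = 1.

(* The triple (C, Ind, U): cover, independent set, undecided nodes. *)
Definition state (V : finType) : Type := ({set V} * {set V} * {set V})%type.

Definition nc_update (V : finType) (e : rel V) (s : state V) (u : V) :
    state V :=
  let: (C, Ind, U) := s in
  let U' := U :\ u in
  (C :|: (nbhd e u :&: U'), u |: Ind, U' :\: nbhd e u).

(* n bounds the number of iterations of the while loop. Each iteration removes
   a node from U, so the bound is never reached when #|U| <= n:
   see nc_loop_unfold. *)
Fixpoint nc_loop (R : realFieldType) (V : finType) (e : rel V) (w : V -> R)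
    (tie : {set V} -> V -> R) (n : nat) (s : state V) : {set V} -> R :=
  let: (C, Ind, U) := s in
  if n is n'.+1 then
    if U == set0 then law_ret R C
    else law_bind (select w tie U)
           (fun u => nc_loop e w tie n' (nc_update e s u))
  else law_ret R C.

(* The law of the set returned by the algorithm. *)
Definition NeighborCover (R : realFieldType) (V : finType) (e : rel V)
    (w : V -> R) (tie : {set V} -> V -> R) : {set V} -> R :=
  nc_loop e w tie #|V| (set0, set0, [set: V]).

Lemma nc_update_card (V : finType) (e : rel V) (C Ind U : {set V}) (u : V) :
  u \in U -> (#|(nc_update e (C, Ind, U) u).2| < #|U|)%N.
Proof.
move=> uU /=; rewrite (cardsD1 u U) uU add1n ltnS.
exact/subset_leq_card/subsetDl.
Qed.

Lemma nc_loop_fuel (R : realFieldType) (V : finType) (e : rel V) (w : V -> R)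
    (tie : {set V} -> V -> R) (n m : nat) (s : state V) :
  (#|s.2| <= n)%N -> (#|s.2| <= m)%N ->
  nc_loop e w tie n s =1 nc_loop e w tie m s.
Proof.
elim: n m s => [|n IHn] [|m] [[C Ind] U] //= Un Um S.
- by move: Un; rewrite leqn0 cards_eq0 => ->.
- by move: Um; rewrite leqn0 cards_eq0 => ->.
case: ifP => // _; apply: eq_bigr => u _.
have [uU|uU] := boolP (u \in U); last by rewrite /select uU !mul0r.
congr (_ * _); have lt := nc_update_card e C Ind uU.
by apply: IHn; rewrite -ltnS; apply: leq_trans lt _.
Qed.

Lemma nc_loop_unfold (R : realFieldType) (V : finType) (e : rel V) (w : V -> R)
    (tie : {set V} -> V -> R) (n : nat) (C Ind U : {set V}) :
  (#|U| <= n)%N ->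
  nc_loop e w tie n (C, Ind, U) =1
    if U == set0 then law_ret R C
    else law_bind (select w tie U)
           (fun u => nc_loop e w tie n (nc_update e (C, Ind, U) u)).
Proof.
by move=> Un S; rewrite (@nc_loop_fuel R V e w tie n n.+1) //; apply: leqW.
Qed.

Lemma select_law (R : realFieldType) (V : finType) (w : V -> R)
    (tie : {set V} -> V -> R) (U : {set V}) :
  (forall v, 0 <= w v) -> tie_law tie -> U != set0 -> is_law (select w tie U).
Proof.
move=> w0 /(_ U) tieU /tieU [t0 t1].
have W0 : 0 <= weight w U by apply: sumr_ge0.
split=> [u|].
  rewrite /select; case: ifPn => // /negPn uU; case: ifP => // _.
    exact: t0.
  exact: divr_ge0.
rewrite (bigID [in U]) /= [X in _ + X]big1 ?addr0; last first.
  by move=> u uU; rewrite /select uU.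
have [W|W] := eqVneq (weight w U) 0.
  by rewrite -[RHS]t1; apply: eq_bigr => u uU; rewrite /select uU W eqxx.
rewrite -[RHS](divff W) {2}/weight mulr_suml.
by apply: eq_bigr => u uU; rewrite /select uU (negPf W).
Qed.

Lemma NeighborCover_law (R : realFieldType) (V : finType) (e : rel V)
    (w : V -> R) (tie : {set V} -> V -> R) :
  (forall v, 0 <= w v) -> tie_law tie -> is_law (NeighborCover e w tie).
Proof.
move=> w0 tieP; rewrite /NeighborCover.
have ret_law C : is_law (law_ret R (C : {set V})).
  split=> [S|]; first exact: ler0n.
  rewrite (bigD1 C) //= big1 ?addr0 /law_ret ?eqxx // => S /negPf ->.
  by [].
elim: #|V| (X in nc_loop _ _ _ _ X) => [|n IHn] [[C Ind] U] /=; first exact: ret_law.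
case: ifPn => [_|U0]; first exact: ret_law.
have [s0 s1] := select_law w0 tieP U0.
split=> [S|].
  by apply: sumr_ge0 => u _; apply: mulr_ge0 => //; case: (IHn (nc_update e (C, Ind, U) u)).
rewrite exchange_big /= -[RHS]s1; apply: eq_bigr => u _.
by rewrite -mulr_sumr; case: (IHn (nc_update e (C, Ind, U) u)) => _ ->; rewrite mulr1.
Qed.

(* Main.v *)
Require Import Defs.
From mathcomp Require Import all_boot all_order all_algebra.

Set Implicit Arguments.
Unset Strict Implicit.
Unset Printing Implicit Defensive.

Import Order.TTheory GRing.Theory Num.Theory.
Local Open Scope ring_scope.

(** Fix a vertex cover S. When u is drawn from the undecided set U, the
    algorithm pays w(N(u) ∩ U), while S pays w(S ∩ N[u] ∩ U) for the nodes that
    become decided. Averaging over u with probability w_u / w(U) turns the former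
    into a sum of w_u w_v over ordered adjacent pairs of U, and the latter is at
    least the same sum restricted to v in S. Since every edge has an endpoint in
    S, symmetry shows that the restricted sum is at least half of the full one.
    So in each step the expected payment is at most twice that of S, and the
    bound follows by induction on the number of steps. *)

Lemma weight_ge0 (R : realFieldType) (V : finType) (w : V -> R) (A : {set V}) :
  (forall v, 0 <= w v) -> 0 <= weight w A.
Proof. by move=> w0; apply: sumr_ge0. Qed.

Lemma weight_subset (R : realFieldType) (V : finType) (w : V -> R)
    (A B : {set V}) :
  (forall v, 0 <= w v) -> A \subset B -> weight w A <= weight w B.
Proof.
move=> w0 AB; rewrite /weight [leRHS](big_setID A) /= (setIidPr AB).
by rewrite lerDl weight_ge0.
Qed.

Lemma weight_setU (R : realFieldType) (V : finType) (w : V -> R)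
    (A B : {set V}) :
  (forall v, 0 <= w v) -> weight w (A :|: B) <= weight w A + weight w B.
Proof.
move=> w0; rewrite /weight [leLHS](big_setID A) /= setUK lerD2l.
by apply: weight_subset; rewrite ?setDUl ?setDv ?set0U ?subsetDl.
Qed.

Lemma expectation_ret (R : realFieldType) (T : finType) (x : T) (f : T -> R) :
  expectation (law_ret R x) f = f x.
Proof.
rewrite /expectation (bigD1 x) //= /law_ret eqxx mul1r big1 ?addr0 // => y.
by move=> /negPf ->; rewrite mul0r.
Qed.

Lemma expectation_bind (R : realFieldType) (T U : finType) (p : T -> R)
    (k : T -> U -> R) (f : U -> R) :
  expectation (law_bind p k) f = expectation p (fun x => expectation (k x) f).
Proof.
rewrite /expectation /law_bind.
under eq_bigr do rewrite mulr_suml.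
rewrite exchange_big /=; apply: eq_bigr => x _.
by rewrite mulr_sumr; apply: eq_bigr => y _; rewrite mulrA.
Qed.

Lemma select_neq0 (R : realFieldType) (V : finType) (w : V -> R)
    (tie : {set V} -> V -> R) (U : {set V}) (u : V) :
  select w tie U u != 0 -> u \in U.
Proof. by rewrite /select; case: ifPn; rewrite ?eqxx ?negbK. Qed.

Lemma adjacent_pairs_cover (R : realFieldType) (V : finType) (e : rel V)
    (w : V -> R) (S U : {set V}) :
  symmetric e -> (forall v, 0 <= w v) -> vertex_cover e S ->
  \sum_(u in U) w u * weight w (nbhd e u :&: U)
    <= 2 * \sum_(u in U) w u * weight w (S :&: (nbhd e u :&: U)).
Proof.
move=> e_sym w0 /forallP coverS.
pose g u v := (e u v)%:R * (w u * w v).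
have expand (A : {set V}) :
    \sum_(u in U) w u * weight w (A :&: (nbhd e u :&: U))
    = \sum_(u in U) \sum_(v in U) (v \in A)%:R * g u v.
  apply: eq_bigr => u _; rewrite /weight mulr_sumr big_mkcond [RHS]big_mkcond /=.
  apply: eq_bigr => v _; rewrite !inE /g.
  by case: (v \in A); case: (e u v); case: (v \in U);
    rewrite ?mul1r ?mul0r ?mulr0.
under eq_bigr do rewrite -[_ :&: _]setTI.
rewrite !expand.
(* Swapping the order of summation in one of the two copies gives each pair [(u, v)] the factor
   [(u \in S) + (v \in S)], which is at least 1 on an edge. *)
rewrite mulr_natl mulr2n [X in _ <= X + _]exchange_big -big_split /=.
apply: ler_sum => u _; rewrite -big_split /=; apply: ler_sum => v _.
have gC : g v u = g u v by rewrite /g e_sym [w v * _]mulrC.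
rewrite gC inE mul1r -mulrDl /g.
have [euv|_] := boolP (e u v); last by rewrite !mul0r mulr0.
rewrite mul1r; apply: ler_peMl; first exact: mulr_ge0.
have /forallP/(_ v) := coverS u; rewrite euv /= -natrD ler1n.
by case: (u \in S); case: (v \in S).
Qed.

Lemma select_cost (R : realFieldType) (V : finType) (e : rel V)
    (w : V -> R) (tie : {set V} -> V -> R) (S U : {set V}) :
  symmetric e -> (forall v, 0 <= w v) -> vertex_cover e S ->
  expectation (select w tie U) (fun u => weight w (nbhd e u :&: U))
    <= 2 * expectation (select w tie U)
             (fun u => weight w (S :&: (nbhd e u :&: U))).
Proof.
move=> e_sym w0 coverS; rewrite /expectation.
(* If [U] has weight zero, so do all its subsets, and both sides vanish for any tie-breaking law. *)
have [W|W] := eqVneq (weight w U) 0.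
  have null (A : {set V}) : A \subset U -> weight w A = 0.
    move=> AU; apply/eqP; rewrite eq_le weight_ge0 // andbT -W.
    exact: weight_subset.
  rewrite !big1 ?mulr0 // => u _; rewrite null ?mulr0 ?subsetIr //.
  by rewrite setIA subsetIr.
have selE (f : V -> R) : \sum_u select w tie U u * f u
    = (weight w U)^-1 * \sum_(u in U) w u * f u.
  rewrite mulr_sumr [RHS]big_mkcond /=; apply: eq_bigr => u _.
  rewrite /select (negPf W); case: (u \in U) => /=; last by rewrite mul0r.
  by rewrite mulrAC mulrC.
rewrite !selE mulrCA; apply: ler_wpM2l; first by rewrite invr_ge0 weight_ge0.
exact: adjacent_pairs_cover.
Qed.

(** The potential is the cost [C] already paid plus twice what [S] still holds among the undecided
    nodes; it does not increase on average. *)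
Lemma nc_loop_cost (R : realFieldType) (V : finType) (e : rel V)
    (w : V -> R) (tie : {set V} -> V -> R) (S : {set V}) (n : nat)
    (C Ind U : {set V}) :
  symmetric e -> (forall v, 0 <= w v) -> tie_law tie -> vertex_cover e S ->
  expectation (nc_loop e w tie n (C, Ind, U)) (weight w)
    <= weight w C + 2 * weight w (S :&: U).
Proof.
move=> e_sym w0 tieP coverS.
have bound0 (A B : {set V}) : weight w A <= weight w A + 2 * weight w B.
  by rewrite lerDl mulr_ge0 ?weight_ge0.
elim: n C Ind U => [|n IHn] C Ind U /=; first by rewrite expectation_ret.
case: ifPn => [_|U0]; first by rewrite expectation_ret.
have [s0 s1] := select_law w0 tieP U0.
rewrite expectation_bind.
have step u :
    expectation (nc_loop e w tie n (nc_update e (C, Ind, U) u)) (weight w)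
    <= (weight w C + 2 * weight w (S :&: U)) + weight w (nbhd e u :&: U)
       - 2 * weight w (S :&: (nbhd e u :&: U)).
  apply: le_trans (IHn _ _ _) _.
  have paid : weight w (C :|: (nbhd e u :&: (U :\ u)))
      <= weight w C + weight w (nbhd e u :&: U).
    apply: le_trans (weight_setU _ _ _) _ => //; rewrite lerD2l.
    by apply: weight_subset => //; apply/setIS/subsetDl.
  (* The share of [u] itself in [S] is given away here: only the part of [S] in [nbhd e u] is needed
     to offset the payment. *)
  have left : weight w (S :&: ((U :\ u) :\: nbhd e u))
      <= weight w (S :&: U) - weight w (S :&: (nbhd e u :&: U)).
    rewrite [weight w (S :&: U)]/weight (big_setID (nbhd e u)) /=.
    rewrite -/(weight w _) -/(weight w _) -setIA [U :&: nbhd e u]setIC addrC addrK.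
    by apply: weight_subset => //; rewrite -setIDA; apply/setIS/setSD/subsetDl.
  rewrite [weight w C + _ + _]addrAC -[leRHS]addrA -mulrBr.
  by apply: lerD => //; apply: ler_wpM2l.
apply: le_trans (ler_sum _ (fun u _ => ler_wpM2l (s0 u) (step u))) _.
under eq_bigr do rewrite mulrBr mulrDr mulrCA.
(* The old potential factors out because the law has mass 1; what remains is the expected payment
   minus twice that of [S]. *)
rewrite sumrB big_split /= -mulr_suml s1 mul1r -mulr_sumr -addrA gerDl subr_le0.
exact: select_cost.
Qed.

(** Invariant: an edge is covered by [C] or has both endpoints undecided. The second case is void
    once [U] is empty, and [#|U| <= n] ensures that the fuel does not run out earlier. *)
Lemma nc_loop_cover (R : realFieldType) (V : finType) (e : rel V)
    (w : V -> R) (tie : {set V} -> V -> R) (n : nat) (C Ind U D : {set V}) :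
  symmetric e -> irreflexive e -> (#|U| <= n)%N ->
  (forall x y, e x y -> [|| x \in C, y \in C | (x \in U) && (y \in U)]) ->
  nc_loop e w tie n (C, Ind, U) D != 0 -> vertex_cover e D.
Proof.
move=> e_sym e_irr.
have stop (C' U' : {set V}) : U' == set0 ->
    (forall x y, e x y -> [|| x \in C', y \in C' | (x \in U') && (y \in U')]) ->
    law_ret R C' D != 0 -> vertex_cover e D.
  move=> /eqP -> inv; rewrite /law_ret; have [->|_] := eqVneq D C'.
    move=> _; apply/forallP => x; apply/forallP => y; apply/implyP => /inv.
    by rewrite !inE orbF.
  by rewrite eqxx.
elim: n C Ind U => [|n IHn] C Ind U Un inv.
  by apply: (stop _ U) => //; rewrite -cards_eq0 -leqn0.
rewrite /=; case: ifPn => [U0|_]; first exact: stop inv.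
rewrite /law_bind => sum_neq0.
(* A nonzero sum has a nonzero term: some node of [U] can be drawn after which [D] is still a
   possible output. *)
have /existsP[u] : [exists u,
    select w tie U u * nc_loop e w tie n (nc_update e (C, Ind, U) u) D != 0].
  apply: contraNT sum_neq0; rewrite negb_exists => /forallP all0.
  by rewrite big1 // => u _; apply/eqP; rewrite -[_ == _]negbK.
rewrite mulf_eq0 negb_or => /andP[/select_neq0 uU].
apply: IHn.
  by rewrite -ltnS; apply: leq_trans Un; apply: (nc_update_card e C Ind uU).
move=> x y exy; have := inv x y exy; rewrite !inE.
have [xu|xu] := eqVneq x u; have [yu|yu] := eqVneq y u.
(* A loop at [u] would stay uncovered, since [u] leaves [U] without entering [C]. *)
- by move: exy; rewrite xu yu e_irr.
- rewrite -xu exy /=; case: (x \in C); case: (y \in C); rewrite ?orbT //=.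
  by move=> /andP[_ ->]; rewrite orbT.
- rewrite -yu e_sym exy /=; case: (x \in C); case: (y \in C); rewrite ?orbT //=.
  by move=> /andP[-> _].
- by case: (x \in C); case: (y \in C); case: (x \in U); case: (y \in U);
    case: (e u x); case: (e u y).
Qed.

Theorem theorem1 (R : realFieldType) (V : finType) (e : rel V)
    (e_sym : symmetric e) (e_irr : irreflexive e)
    (w : V -> R) (w_ge0 : forall v, 0 <= w v)
    (tie : {set V} -> V -> R) (tieP : tie_law tie) :
  (forall C : {set V}, 0 < NeighborCover e w tie C -> vertex_cover e C) /\
  expectation (NeighborCover e w tie) (weight w) <= 2 * min_cover_weight e w.
Proof.
split=> [C /lt0r_neq0|].
  apply: nc_loop_cover => //; first by rewrite cardsT.
  by move=> x y _; rewrite !inE !orbT.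
have cost S : vertex_cover e S ->
    expectation (NeighborCover e w tie) (weight w) <= 2 * weight w S.
  move=> coverS.
  have := nc_loop_cost #|V| set0 set0 [set: V] e_sym w_ge0 tieP coverS.
  by rewrite setIT {2}/weight big_set0 add0r.
(* The bound holds at the default value, as [[set: V]] is a cover, and passes to the minimum of two
   values. *)
rewrite /min_cover_weight; elim/big_ind: _ => [|x y Ex Ey|S /cost //].
  by apply: cost; apply/forallP => u; apply/forallP => v; rewrite !inE implybT.
by case: (leP x y).
Qed.
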